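(* Let $f\colon\mathbb{R}\to\left]-\infty,+\infty\right]$ be given by $f(x)=-\ln(x)$ if $x>0$ and $f(x)=+\infty$ if $x\le0$, and let $C=\{(x,x^* )\in\mathbb{R}\times\mathbb{R}\mid x^*\le-\tfrac1x<0\}$. Then the functions $\mathcal{A}_{\partial f}$, $\mathcal{B}_{\partial f}$, and $f\oplus f^*$ have domains $\tfrac1{\sqrt2}C$, $\tfrac12C$, and $\left]0,+\infty\right[\times\left]-\infty,0\right[$, respectively. Consequently, they are three different autoconjugate representers for $\partial f$.
   Context: Here $X=X^*=\mathbb{R}$ with pairing $\langle x,x^*\rangle=xx^*$ and norm $|\cdot|$. The domain of an extended-real-valued function is the set where it is $<+\infty$; $tC=\{(tx,tx^* )\mid(x,x^* )\in C\}$. $\partial f$ is the (convex) subdifferential operator of $f$, with graph $\operatorname{gra}\partial f=\{(x,x^* )\mid\forall y\in\mathbb{R}:\ (y-x)x^*+f(x)\le f(y)\}$ (with $x\in\operatorname{dom}f$). $f^*(x^* )=\sup_{x\in\mathbb{R}}xx^*-f(x)$ is the Fenchel conjugate and $(f\oplus f^* )(x,x^* )=f(x)+f^*(x^* )$. For $F\colon\mathbb{R}\times\mathbb{R}\to\left]-\infty,+\infty\right]$, $F^*(x^*,x)=\sup_{(y,y^* )\in\mathbb{R}^2}yx^*+xy^*-F(y,y^* )$ and $F^{*\intercal}(x,x^* )=F^*(x^*,x)$. For $A=\partial f$, the Fitzpatrick function is $F_A(x,x^* )=\sup_{(y,y^* )\in\operatorname{gra}A}xy^*+yx^*-yy^*$,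 and $$\mathcal{A}_A(x,x^* )=\inf_{y^*\in\mathbb{R}}\tfrac12F_A(x,x^*+y^* )+\tfrac12F_A^{*\intercal}(x,x^*-y^* ),$$ $$\mathcal{B}_A(x,x^* )=\inf_{(y,y^* )\in\mathbb{R}^2}\tfrac12F_A(x+y,x^*+y^* )+\tfrac12F_A^{*\intercal}(x-y,x^*-y^* )+\tfrac12|y|^2+\tfrac12|y^*|^2.$$ $F$ is autoconjugate if $F^*(x^*,x)=F(x,x^* )$ for all $(x,x^* )$; $F$ is a representer for $A$ if, for all $(x,x^* )$, $F(x,x^* )=xx^*$ holds exactly when $(x,x^* )\in\operatorname{gra}A$. An autoconjugate representer is a function that is both. *)

(* Defs.v *)
From HB Require Import structures.
From mathcomp Require Import all_boot all_order all_algebra.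
From mathcomp Require Import all_classical all_reals all_analysis.

Set Implicit Arguments.
Unset Strict Implicit.
Unset Printing Implicit Defensive.

Import Order.TTheory GRing.Theory Num.Theory.

Local Open Scope classical_set_scope.
Local Open Scope ring_scope.
Local Open Scope ereal_scope.

Section definitions.
Context {R : realType}.
Implicit Types (f : R -> \bar R) (A C : set (R * R)) (F G : R * R -> \bar R).

Definition domain (T : Type) (g : T -> \bar R) : set T := [set z | g z < +oo].

Definition scale_set (t : R) C : set (R * R) :=
  [set (t * z.1, t * z.2)%R | z in C].

(* Operators are represented by their graphs. *)
Definition subdifferential f : set (R * R) :=
  [set z | domain f z.1 /\
           forall y : R, ((y - z.1) * z.2)%:E + f z.1 <= f y].

Definition fenchel_conjugate f (xs : R) : \bar R :=
  ereal_sup [set (x * xs)%:E - f x | x in [set: R]].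

Definition direct_sum f g (z : R * R) : \bar R := f z.1 + g z.2.

(* The argument is u = (x^*, x), the dual variable coming first. *)
Definition conjugate2 F (u : R * R) : \bar R :=
  ereal_sup [set (w.1 * u.1 + u.2 * w.2)%:E - F w | w in [set: R * R]].

Definition transpose G (z : R * R) : \bar R := G (z.2, z.1).

Definition fitzpatrick A (z : R * R) : \bar R :=
  ereal_sup [set (z.1 * w.2 + w.1 * z.2 - w.1 * w.2)%:E | w in A].

Definition calA A (z : R * R) : \bar R :=
  ereal_inf [set (1 / 2)%:E * fitzpatrick A (z.1, z.2 + ys)%R
               + (1 / 2)%:E
                 * transpose (conjugate2 (fitzpatrick A)) (z.1, z.2 - ys)%R
            | ys in [set: R]].

Definition calB A (z : R * R) : \bar R :=
  ereal_inf [set (1 / 2)%:E * fitzpatrick A (z.1 + w.1, z.2 + w.2)%R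
               + (1 / 2)%:E
                 * transpose (conjugate2 (fitzpatrick A))
                     (z.1 - w.1, z.2 - w.2)%R
               + (1 / 2 * `|w.1| ^+ 2)%:E + (1 / 2 * `|w.2| ^+ 2)%:E
            | w in [set: R * R]].

(* The first conjunct says that F takes its values in ]-oo, +oo]. *)
Definition autoconjugate F : Prop :=
  (forall z, F z != -oo) /\
  forall x xs : R, conjugate2 F (xs, x) = F (x, xs).

Definition representer A F : Prop :=
  forall x xs : R, F (x, xs) = (x * xs)%:E <-> A (x, xs).

Definition autoconjugate_representer A F : Prop :=
  autoconjugate F /\ representer A F.

Definition neg_ln (x : R) : \bar R := if (0 < x)%R then (- ln x)%:E else +oo.

(* Since 1 / 0 = 0 here, the strict inequality already excludes z.1 = 0. *)
Definition hyperbolic_set : set (R * R) := [set z | (z.2 <= - (1 / z.1) < 0)%R].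

End definitions.

(* Main.v *)
Require Import Defs.
From HB Require Import structures.
From mathcomp Require Import all_boot all_order all_algebra.
From mathcomp Require Import all_classical all_reals all_analysis.
From mathcomp Require Import ring lra.

Set Implicit Arguments.
Unset Strict Implicit.
Unset Printing Implicit Defensive.

Import Order.TTheory GRing.Theory Num.Theory.
Import numFieldNormedType.Exports.

Local Open Scope classical_set_scope.
Local Open Scope ring_scope.

(** Write p for - xs. The graph of the subdifferential of f = - ln is the
    hyperbola x p = 1 with x > 0, so its Fitzpatrick function F is
    1 - 2 sqrt (x p) on the closed quadrant x, p >= 0, and the transposed
    conjugate G of F is - 1 on the convex set C (x > 0, x p >= 1); both are
    +oo elsewhere ([fitzpatrick_neg_ln], [conjugate_fitzpatrick_neg_ln]).

    Two of the three functions have closed forms.  In calA the infimum over ys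
    is reached when (x, xs - ys) meets the boundary of C, which gives
    - sqrt (2 x p - 1) on 2 x p >= 1 ([calA_neg_ln]).  The direct sum is
    - ln x - ln p - 1 on x, p > 0.  For both, the conjugate is computed by an
    inequality (Cauchy-Schwarz, respectively ln t <= t - 1) together with points
    where it is sharp or nearly so, and the contact set with the coupling is
    read off the formula.

    The function calB has no convenient closed form.  At (x, - p) it is the
    infimum of [cost] over the c in C for which a = 2 (x, p) - c lies in the
    closed quadrant.  These c form a compact set, so the infimum is attained
    where it is finite, that is, where x > 0 and 4 x p >= 1.  Autoconjugacy is
    Fenchel duality for this minimization.  Weak duality is the sum of two
    Fenchel-Young inequalities and a square ([cost_weak_duality]).  For strong
    duality, a minimizer c satisfies a variational inequality over all of C
    ([minimizer_stationary]); this inequality says that the derivative of the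
    cost, read in the dual plane, and the gradient of the square root form a
    dual pair reaching the same value ([cost_strong_duality]).  On the boundary
    4 x p = 1 the square root has no gradient at the minimizer, and an explicit
    dual pair is available.  Outside the domain, the conjugate is +oo because
    of a ray on which the square root beats the linear part
    ([hyperbola_unbounded]).  Equality of calB with the coupling makes a sum of
    nonnegative terms vanish, which forces x p = 1 ([cost_eq_coupling]).

    The three functions differ because their domains x p >= 1/2, x p >= 1/4 and
    x p > 0, in the quadrant x, p > 0, do. *)

(** * Suprema and inequalities on the hyperbola *)

Lemma ereal_sup_fin (R : realType) (T : Type) (S : set T) (g : T -> \bar R)
    (l : R) :
  (forall w, S w -> (g w <= l%:E)%E) ->
  (forall e : R, 0 < e -> exists2 w, S w & ((l - e)%:E <= g w)%E) ->
  ereal_sup [set g w | w in S] = l%:E.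
Proof.
move=> ub approx; apply/eqP; rewrite eq_le; apply/andP; split.
  by apply: ge_ereal_sup => _ [w Sw <-]; exact: ub.
apply/lee_addgt0Pr => e e0; have [w Sw hw] := approx e e0.
rewrite -leeBlDr//; apply: le_ereal_sup_tmp; exists (g w) => //.
by exists w.
Qed.

Lemma ereal_sup_infty (R : realType) (T : Type) (S : set T) (g : T -> \bar R) :
  (forall M : R, exists2 w, S w & (M%:E <= g w)%E) ->
  ereal_sup [set g w | w in S] = +oo%E.
Proof.
move=> unb; apply: eq_infty => M.
have [w Sw hw] := unb M.
by apply: le_ereal_sup_tmp; exists (g w) => //; exists w.
Qed.

(** The two products regroup as (y p)(x q), so this is the arithmetic-geometric
    mean inequality for y p and x q.  The left side only sees the positions of
    (x, p) and (y, q) relative to the hyperbolas; it is the Fenchel-Young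
    inequality for the Fitzpatrick function when one of the points lies in C. *)
Lemma cross_amgm (R : realType) (x p y q : R) :
  0 <= x -> 0 <= p -> 0 <= y -> 0 <= q ->
  2 * (Num.sqrt (x * p) * Num.sqrt (y * q)) <= y * p + x * q.
Proof.
move=> x0 p0 y0 q0.
have -> : Num.sqrt (x * p) * Num.sqrt (y * q)
        = Num.sqrt (y * p) * Num.sqrt (x * q).
  rewrite -!sqrtrM ?mulr_ge0//; congr Num.sqrt; ring.
have h1 : Num.sqrt (y * p) ^+ 2 = y * p by rewrite sqr_sqrtr// mulr_ge0.
have h2 : Num.sqrt (x * q) ^+ 2 = x * q by rewrite sqr_sqrtr// mulr_ge0.
have := sqr_ge0 (Num.sqrt (y * p) - Num.sqrt (x * q)).
rewrite sqrrB h1 h2; lra.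
Qed.

(** The infimum 2 sqrt (x p) is reached at y = sqrt (x / p) for positive x and
    p, but only approached, as y tends to 0 or to +oo, when one of them is 0;
    hence the e. *)
Lemma hyperbola_approx_min (R : realType) (x p e : R) :
  0 <= x -> 0 <= p -> 0 < e ->
  exists2 y, 0 < y & x / y + y * p <= 2 * Num.sqrt (x * p) + e.
Proof.
rewrite le_eqVlt => /predU1P[<- p0 e0|x0].
  exists (e / (p + 1)); first by rewrite divr_gt0//; lra.
  rewrite !mul0r sqrtr0 mulr0 !add0r mulrAC ler_pdivrMr; nra.
rewrite le_eqVlt => /predU1P[<- e0|p0 e0].
  exists (x / e); first by rewrite divr_gt0.
  by rewrite !mulr0 sqrtr0 mulr0 add0r addr0 invf_div mulrC divfK ?gt_eqF.
set s := Num.sqrt (x * p).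
have s0 : 0 < s by rewrite sqrtr_gt0 mulr_gt0.
have s2 : s ^+ 2 = x * p by rewrite sqr_sqrtr// ltW// mulr_gt0.
exists (s / p); first by rewrite divr_gt0.
have -> : x / (s / p) = s.
  by rewrite invf_div mulrA -s2 expr2 mulfK// gt_eqF.
rewrite divfK ?gt_eqF//; lra.
Qed.

(** If x <= 0, increasing q costs nothing and the square root grows; if p <= 0,
    increasing y does.  Otherwise both terms are homogeneous of degree 1 along
    the ray through (x, p), with slope g sqrt (x p) - 2 x p > 0.  The constants
    g = 2, sqrt 2 and 1 serve the conjugates of the Fitzpatrick function, of
    calA and of calB. *)
Lemma hyperbola_unbounded (R : realType) (g x p M : R) :
  0 < g -> ~ [/\ 0 < x, 0 < p & g ^+ 2 <= 4 * (x * p)] ->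
  exists y q, [/\ 0 < y, 0 < q, 1 <= y * q &
    M <= g * Num.sqrt (y * q) - (y * p + x * q)].
Proof.
move=> g0 nH.
(* N makes g N dominate M plus the linear term on the unmoved axis. *)
pose N := 1 + `|M| / g + `|x| / g + `|p| / g.
have hM : 0 <= `|M| / g by rewrite divr_ge0// ltW.
have hx : 0 <= `|x| / g by rewrite divr_ge0// ltW.
have hp : 0 <= `|p| / g by rewrite divr_ge0// ltW.
have N1 : 1 <= N by rewrite /N; lra.
have gN : g * N = g + `|M| + `|x| + `|p|.
  by rewrite /N !mulrDr mulr1 !(mulrC g) !divfK// gt_eqF.
have N0 : 0 <= N by lra.
have NN : 1 <= N ^+ 2 by rewrite exprn_ege1.
have lM := ler_norm M; have lx := ler_norm x; have lp := ler_norm p.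
have nM := normr_ge0 M; have nx := normr_ge0 x; have np := normr_ge0 p.
case: (leP x 0) => x0.
  exists 1, (N ^+ 2); split=> //; [lra|by rewrite mul1r|].
  rewrite mul1r sqrtr_sqr ger0_norm// gN.
  have : x * N ^+ 2 <= 0 by rewrite mulr_le0_ge0// sqr_ge0.
  lra.
case: (leP p 0) => p0.
  exists (N ^+ 2), 1; split=> //; [lra|by rewrite mulr1|].
  rewrite mulr1 sqrtr_sqr ger0_norm// gN.
  have : N ^+ 2 * p <= 0 by rewrite mulr_ge0_le0// sqr_ge0.
  lra.
have {nH} xpg : 4 * (x * p) < g ^+ 2.
  by rewrite ltNge; apply/negP => h; apply: nH.
set s := Num.sqrt (x * p).
have s0 : 0 < s by rewrite sqrtr_gt0 mulr_gt0.
have s2 : s ^+ 2 = x * p by rewrite sqr_sqrtr// ltW// mulr_gt0.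
have sg : 2 * s < g by rewrite -s2 in xpg; nra.
pose d := s * (g - 2 * s).
have d0 : 0 < d by rewrite mulr_gt0//; lra.
(* The first term of L enters the region y q >= 1, the second exceeds M. *)
pose L := 1 / s + `|M| / d.
have L0 : 0 < L by rewrite ltr_pwDl ?divr_ge0 ?divr_gt0// ltW.
have Ls : 1 <= L * s.
  by rewrite mulrDl divfK ?gt_eqF// lerDl mulr_ge0// ?divr_ge0// ltW.
have Ld : M <= L * d.
  rewrite mulrDl divfK ?gt_eqF//.
  by apply: (le_trans lM); rewrite lerDr mulr_ge0// ?divr_ge0// ltW.
have E : L * x * (L * p) = (L * s) ^+ 2 by rewrite exprMn s2; ring.
exists (L * x), (L * p); split; rewrite ?mulr_gt0// E.
  by rewrite exprn_ege1.
rewrite sqrtr_sqr ger0_norm; last lra.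
apply: (le_trans Ld).
have -> : L * x * p + x * (L * p) = L * (2 * s ^+ 2) by rewrite s2; ring.
by rewrite /d; lra.
Qed.

(** * The graph of the subdifferential and its Fitzpatrick function *)

Lemma ln_lt_sub1 (R : realType) (t : R) : 0 < t -> t != 1 -> ln t < t - 1.
Proof.
move=> t0 t1; have lt0 : ln t != 0 by rewrite ln_eq0.
by have := expR_gt1Dx lt0; rewrite lnK//; lra.
Qed.

Lemma ln_le_sub1 (R : realType) (t : R) : 0 < t -> ln t <= t - 1.
Proof.
move=> t0; have [->|t1] := eqVneq t 1; first by rewrite ln1 subrr.
exact/ltW/ln_lt_sub1.
Qed.

(** With y = x s and m = - x xs, the subgradient inequality becomes
    ln s <= m (s - 1) for all s > 0.  Taking s = 2 gives m > 0, and s = 1 / m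
    gives ln m >= m - 1, whose only solution is m = 1. *)
Lemma subdifferential_neg_ln (R : realType) :
  subdifferential (@neg_ln R) = [set z | 0 < z.1 /\ z.1 * z.2 = -1].
Proof.
apply/seteqP; split=> [[x xs]|[x xs]] /=; rewrite /subdifferential /domain /=.
  rewrite /neg_ln; case: ifPn => [x0 [_ H]|_ [] //]; split=> //.
  have {}H s : 0 < s -> ln s <= - (x * xs) * (s - 1).
    move=> s0; have := H (x * s); rewrite mulr_gt0// -EFinD lee_fin lnM ?posrE//.
    nra.
  set m := - (x * xs) in H.
  have m0 : 0 < m.
    have := H 2 ltac:(lra); have := @ln_gt0 R 2 ltac:(lra); lra.
  have [m1|m1] := eqVneq m 1; first by rewrite -[x * xs]opprK -/m m1.
  have := ln_lt_sub1 m0 m1.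
  have := H m^-1; rewrite invr_gt0 => /(_ m0).
  rewrite lnV ?posrE// mulrBr divff ?gt_eqF//; lra.
move=> [x0 xxs]; rewrite /neg_ln x0; split; first exact: ltry.
move=> y; case: ifPn => y0; last by rewrite leey.
rewrite -EFinD lee_fin.
have := ln_le_sub1 (divr_gt0 y0 x0); rewrite ln_div ?posrE//.
have -> : xs = - x^-1.
  by apply: (mulfI (lt0r_neq0 x0)); rewrite mulrN divff ?gt_eqF.
by rewrite mulrN mulrBl divff ?gt_eqF//; lra.
Qed.

Definition fitzpatrick_log (R : realType) (z : R * R) : \bar R :=
  if (0 <= z.1) && (z.2 <= 0) then (1 - 2 * Num.sqrt (- (z.1 * z.2)))%:E
  else +oo%E.

Definition conjugate_log (R : realType) (z : R * R) : \bar R :=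
  if (0 < z.1) && (z.1 * z.2 <= -1) then (-1)%:E else +oo%E.

(** On the hyperbola the supremum is that of 1 - (x / y + y p) over y > 0.
    It is infinite as y tends to 0 when x < 0, and as y tends to +oo when
    p < 0. *)
Lemma fitzpatrick_neg_ln (R : realType) :
  fitzpatrick (subdifferential (@neg_ln R)) = @fitzpatrick_log R.
Proof.
apply/funext => -[x xs]; rewrite /fitzpatrick subdifferential_neg_ln.
have graph (y : R) : 0 < y -> 0 < y /\ y * - y^-1 = -1.
  by move=> y0; rewrite mulrN divff ?gt_eqF.
rewrite /fitzpatrick_log /=; case: ifPn => [/andP[x0 xs0]|].
  apply: ereal_sup_fin => [[y ys] /= [y0 yys]|e e0].
    rewrite lee_fin yys.
    have ys0 : 0 <= - ys by nra.
    have xs0' : 0 <= - xs by lra.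
    have := cross_amgm x0 xs0' (ltW y0) ys0.
    by rewrite [y * - ys]mulrN yys opprK sqrtr1 [x * - xs]mulrN; lra.
  have xs0' : 0 <= - xs by lra.
  have [y y0 hy] := hyperbola_approx_min x0 xs0' e0.
  exists (y, - y^-1) => /=; first exact: graph.
  by move: hy; rewrite lee_fin !mulrN divff ?gt_eqF//; lra.
move=> nH; apply: ereal_sup_infty => M.
have lM := ler_norm M; have nM := normr_ge0 M.
have [x0|x0] := ltP x 0.
  pose N := `|M| + `|xs| - x.
  have nxs := normr_ge0 xs.
  have N0 : 0 < N by rewrite /N; lra.
  have y0 : 0 < - x / N by rewrite divr_gt0// oppr_gt0.
  exists (- x / N, - (- x / N)^-1) => /=; first exact: graph.
  have y1 : - x / N <= 1 by rewrite ler_pdivrMr// /N; lra.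
  have xy : x / (- x / N) = - N.
    by field; rewrite ?oppr_eq0 (ltr0_neq0 x0) (lt0r_neq0 N0).
  rewrite lee_fin mulrN xy opprK mulrN divff ?gt_eqF//.
  have : `|- x / N * xs| <= `|xs|.
    by rewrite normrM ger0_norm ?(ltW y0)// ler_piMl.
  by rewrite ler_norml => /andP[+ _]; rewrite /N; lra.
have {nH} xs0 : 0 < xs by move: nH; rewrite x0 /= -ltNge.
pose N := `|M| + x + xs.
have N0 : 0 < N by rewrite /N; lra.
have y0 : 0 < N / xs by rewrite divr_gt0.
exists (N / xs, - (N / xs)^-1) => /=; first exact: graph.
rewrite lee_fin mulrN divfK ?gt_eqF// mulrN divff ?gt_eqF//.
have : x / (N / xs) <= x.
  by rewrite ler_pdivrMr// ler_peMr// ler_pdivlMr// /N; lra.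
by rewrite /N; lra.
Qed.

(** The function being maximized is - 1 - (y p + x q - 2 sqrt (y q)); the
    parenthesis is nonnegative on the quadrant when x p >= 1, so the origin is
    optimal. *)
Lemma conjugate_fitzpatrick_neg_ln (R : realType) :
  transpose (conjugate2 (fitzpatrick (subdifferential (@neg_ln R))))
  = @conjugate_log R.
Proof.
apply/funext => -[x xs]; rewrite fitzpatrick_neg_ln /transpose /conjugate2 /=.
rewrite /conjugate_log /=; case: ifPn => [/andP[x0 xxs]|nH].
  apply: ereal_sup_fin => [[y ys] _ /=|e e0].
    rewrite /fitzpatrick_log /=; case: ifPn => [/andP[y0 ys0]|_]; last first.
      by rewrite /= leNye.
    rewrite -EFinB lee_fin.
    have xs0 : 0 <= - xs by nra.
    have ys0' : 0 <= - ys by lra.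
    have := cross_amgm (ltW x0) xs0 y0 ys0'.
    rewrite !mulrN.
    have : 1 <= Num.sqrt (- (x * xs)) by rewrite -sqrtr1 ler_wsqrtr//; lra.
    have := sqrtr_ge0 (- (y * ys)).
    by nra.
  exists (0, 0) => //=.
  rewrite /fitzpatrick_log /= lexx /= !mul0r !mulr0 oppr0 sqrtr0 mulr0 -EFinB.
  by rewrite lee_fin; lra.
apply: ereal_sup_infty => M.
have [] := @hyperbola_unbounded R 2 x (- xs) (M + 1).
- lra.
- by move=> [x0 _ h]; move: nH; rewrite x0 /= => /negP; apply; nra.
move=> y [q [y0 q0 _ hM]]; exists (y, - q) => //=.
rewrite /fitzpatrick_log /= (ltW y0) oppr_le0 (ltW q0) /= -EFinB lee_fin.
by rewrite [y * - q]mulrN opprK; lra.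
Qed.

(** * The closed form of calA *)

Lemma le_sqrt_of_sqr (R : realType) (a b : R) : a ^+ 2 <= b -> a <= Num.sqrt b.
Proof.
by move=> ab; apply: (le_trans (ler_norm a)); rewrite -sqrtr_sqr ler_wsqrtr.
Qed.

(** calA is the average of F and G with the first variable held fixed. *)
Definition average_log (R : realType) (z : R * R) : \bar R :=
  if (0 < z.1) && (2 * (z.1 * z.2) <= -1)
  then (- Num.sqrt (- (2 * (z.1 * z.2)) - 1))%:E else +oo%E.

Lemma calA_neg_ln (R : realType) :
  calA (subdifferential (@neg_ln R)) = @average_log R.
Proof.
apply/funext => -[x xs]; rewrite /calA.
rewrite conjugate_fitzpatrick_neg_ln fitzpatrick_neg_ln /=.
apply/eqP; rewrite eq_le; apply/andP; split.
  rewrite /average_log /=; case: ifPn => [/andP[x0 xxs]|_]; last by rewrite leey.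
  (* For this ys, x (xs - ys) = - 1: the second argument lies on the boundary
     of C, and the first one is as far from the axis as C allows. *)
  apply: ereal_inf_lbound; exists (xs + x^-1) => //=.
  have e1 : x * (xs + (xs + x^-1)) = 2 * (x * xs) + 1.
    by rewrite !mulrDr divff ?gt_eqF//; ring.
  have e2 : x * (xs - (xs + x^-1)) = -1.
    by rewrite opprD addrA subrr add0r mulrN divff ?gt_eqF.
  rewrite /fitzpatrick_log /conjugate_log /= e1 e2 lexx x0 (ltW x0) /=.
  have -> : xs + (xs + x^-1) <= 0 by rewrite -(pmulr_rle0 _ x0) e1; lra.
  by rewrite -!EFinM -EFinD opprD; congr EFin; lra.
apply: le_ereal_inf_tmp => _ [ys _ <-].
rewrite /fitzpatrick_log /conjugate_log /=.
case: ifPn => [/andP[x0 h1]|_]; last first.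
  by case: ifPn => _; rewrite gt0_muley ?lte_fin ?divr_gt0 ?addye ?leey// -EFinM.
case: ifPn => [/andP[x1 h2]|_]; last first.
  by rewrite gt0_muley ?lte_fin ?divr_gt0// -EFinM addey ?leey.
rewrite /average_log /= x1 /=.
have -> : 2 * (x * xs) <= -1 by nra.
rewrite -!EFinM -EFinD lee_fin.
have : Num.sqrt (- (x * (xs + ys))) <= Num.sqrt (- (2 * (x * xs)) - 1).
  by rewrite ler_wsqrtr//; lra.
lra.
Qed.

(** Put r^2 = 2 x p - 1 and s^2 = 2 y q - 1.  Then
    (y p + x q)^2 >= 4 x p y q = (1 + r^2) (1 + s^2) >= (r + s)^2, which bounds
    the conjugate by - r.  Equality holds for (y, q) proportional to (x, p) with
    r s = 1; when r = 0 this point is at infinity and the supremum is only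
    approached. *)
Lemma autoconjugate_average_log (R : realType) : autoconjugate (@average_log R).
Proof.
split=> [z|x xs]; first by rewrite /average_log; case: ifP.
rewrite /conjugate2 {2}/average_log /=; case: ifPn => [/andP[x0 xxs]|nH]; last first.
  apply: ereal_sup_infty => M.
  have s2 : 0 < Num.sqrt 2 :> R by rewrite sqrtr_gt0.
  have s22 : Num.sqrt 2 ^+ 2 = 2 :> R by rewrite sqr_sqrtr.
  have [] := @hyperbola_unbounded R (Num.sqrt 2) x (- xs) (M + 1) s2.
    by rewrite s22 => -[x0 _ h]; move: nH; rewrite x0 /= => /negP; apply; nra.
  move=> y [q [y0 q0 yq hM]]; exists (y, - q) => //=.
  rewrite /average_log /= y0 /=.
  have -> : 2 * (y * - q) <= -1 by nra.
  rewrite -EFinB lee_fin.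
  have : Num.sqrt 2 * Num.sqrt (y * q) - 1 <= Num.sqrt (- (2 * (y * - q)) - 1).
    have q2 : Num.sqrt (y * q) ^+ 2 = y * q by rewrite sqr_sqrtr ?mulr_ge0// ltW.
    have s1 : 1 <= Num.sqrt 2 :> R by rewrite -{1}sqrtr1 ler_wsqrtr// ler1n.
    have q1 : 1 <= Num.sqrt (y * q) by rewrite -[leLHS]sqrtr1 ler_wsqrtr.
    have t1 : 1 <= Num.sqrt 2 * Num.sqrt (y * q) by rewrite mulr_ege1.
    apply: le_sqrt_of_sqr; rewrite sqrrB exprMn s22 q2 mulrN.
    by rewrite expr1n !mulr1; lra.
  lra.
set r := Num.sqrt _.
have r0 : 0 <= r by exact: sqrtr_ge0.
have r2 : r ^+ 2 = - (2 * (x * xs)) - 1 by rewrite sqr_sqrtr//; lra.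
have xs0 : 0 < - xs by nra.
apply: ereal_sup_fin => [[y ys] _ /=|e e0].
  rewrite /average_log /=; case: ifPn => [/andP[y0 yys]|_]; last first.
    by rewrite leNye.
  have ys0 : 0 < - ys by nra.
  set s := Num.sqrt (_ - 1).
  have s0 : 0 <= s by exact: sqrtr_ge0.
  have s2 : s ^+ 2 = - (2 * (y * ys)) - 1 by rewrite sqr_sqrtr//; lra.
  have := cross_amgm (ltW x0) (ltW xs0) (ltW y0) (ltW ys0).
  set P := Num.sqrt (x * _); set Q := Num.sqrt (y * _) => PQ.
  have P0 : 0 <= P by exact: sqrtr_ge0.
  have Q0 : 0 <= Q by exact: sqrtr_ge0.
  have P2 : 2 * P ^+ 2 = 1 + r ^+ 2.
    by rewrite sqr_sqrtr; [lra|rewrite mulr_ge0// ltW].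
  have Q2 : 2 * Q ^+ 2 = 1 + s ^+ 2.
    by rewrite sqr_sqrtr; [lra|rewrite mulr_ge0// ltW].
  have : r + s <= 2 * (P * Q).
    rewrite -ler_sqr ?nnegrE ?addr_ge0// ?mulr_ge0//.
    have -> : (2 * (P * Q)) ^+ 2 = (2 * P ^+ 2) * (2 * Q ^+ 2) by ring.
    by rewrite P2 Q2; have := sqr_ge0 (1 - r * s); nra.
  by rewrite -EFinB lee_fin; lra.
have [r00|r_neq0] := eqVneq r 0.
  (* 2 e l >= 1 + e^2 is what (l - e)^2 <= l^2 - 1 requires. *)
  pose l := 1 + (1 + e ^+ 2) / (2 * e).
  have le1 : 2 * e * l = 2 * e + 1 + e ^+ 2.
    by rewrite /l; field; exact: lt0r_neq0.
  have l1 : 1 <= l by rewrite lerDl divr_ge0//; nra.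
  have xxs1 : 2 * (x * xs) = -1 by move: r2; rewrite r00; lra.
  exists (l * x, l * xs) => //=; rewrite /average_log /= mulr_gt0//=; last lra.
  have -> : 2 * (l * x * (l * xs)) = - l ^+ 2.
    have -> : 2 * (l * x * (l * xs)) = l ^+ 2 * (2 * (x * xs)) by ring.
    by rewrite xxs1; lra.
  have -> : - l ^+ 2 <= -1 by rewrite lerN2 exprn_ege1.
  rewrite -EFinB lee_fin r00.
  have : l - e <= Num.sqrt (- - l ^+ 2 - 1).
    by apply: le_sqrt_of_sqr; nra.
  have -> : l * x * xs + x * (l * xs) = - l.
    have -> : l * x * xs + x * (l * xs) = l * (2 * (x * xs)) by ring.
    by rewrite xxs1; lra.
  lra.
have r_gt0 : 0 < r by rewrite lt_neqAle eq_sym r_neq0.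
exists (x / r, xs / r) => //=; rewrite /average_log /= divr_gt0//=.
have E : 2 * (x / r * (xs / r)) = - (r^-1 ^+ 2) - 1.
  have -> : 2 * (x / r * (xs / r)) = 2 * (x * xs) / r ^+ 2 by field.
  have -> : 2 * (x * xs) = - r ^+ 2 - 1 by lra.
  by field.
have -> : 2 * (x / r * (xs / r)) <= -1 by rewrite E; have := sqr_ge0 r^-1; lra.
rewrite E -EFinB lee_fin.
have -> : - (- r^-1 ^+ 2 - 1) - 1 = r^-1 ^+ 2 by ring.
rewrite sqrtr_sqr ger0_norm ?invr_ge0//.
have -> : x / r * xs + x * (xs / r) = 2 * (x * xs) / r by field.
have -> : 2 * (x * xs) = - r ^+ 2 - 1 by lra.
have -> : (- r ^+ 2 - 1) / r = - r - r^-1 by field.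
lra.
Qed.

(** With u = x xs, squaring - sqrt (- 2 u - 1) = u gives (u + 1)^2 = 0. *)
Lemma representer_average_log (R : realType) :
  representer (subdifferential (@neg_ln R)) (@average_log R).
Proof.
move=> x xs; rewrite subdifferential_neg_ln /average_log /=; split; last first.
  move=> [-> ->] /=; have -> : 2 * -1 <= -1 :> R by lra.
  have -> : - (2 * -1) - 1 = 1 :> R by lra.
  by rewrite sqrtr1.
case: ifPn => // /andP[x0 xxs] [h]; split=> //.
have : Num.sqrt (- (2 * (x * xs)) - 1) ^+ 2 = (x * xs) ^+ 2.
  by rewrite -[in RHS]h sqrrN.
rewrite sqr_sqrtr; last lra.
move=> h2; have /eqP : (x * xs + 1) ^+ 2 = 0 by rewrite sqrrD -h2; lra.
by rewrite sqrf_eq0 => /eqP; lra.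
Qed.

(** * The direct sum of - ln and its conjugate *)

Definition separable_log (R : realType) (z : R * R) : \bar R :=
  if (0 < z.1) && (z.2 < 0) then (- ln z.1 - ln (- z.2) - 1)%:E else +oo%E.

Lemma fenchel_conjugate_neg_ln (R : realType) (xs : R) :
  fenchel_conjugate (@neg_ln R) xs
  = if xs < 0 then (- ln (- xs) - 1)%:E else +oo%E.
Proof.
rewrite /fenchel_conjugate /neg_ln; case: ifPn => [xs0|nH].
  have p0 : 0 < - xs by rewrite oppr_gt0.
  apply: ereal_sup_fin => [y _|e e0].
    case: ifPn => y0; last by rewrite leNye.
    rewrite -EFinB lee_fin; have := ln_le_sub1 (mulr_gt0 y0 p0).
    by rewrite lnM ?posrE//; lra.
  have y0 : 0 < (- xs)^-1 by rewrite invr_gt0.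
  exists (- xs)^-1 => //; rewrite y0 -EFinB lee_fin lnV ?posrE//.
  by rewrite invrN mulNr mulVf ?lt_eqF//; lra.
apply: ereal_sup_infty => M; exists (expR M) => //.
rewrite expR_gt0 expRK -EFinB lee_fin.
have : 0 <= expR M * xs by rewrite mulr_ge0 ?expR_ge0// leNgt.
lra.
Qed.

Lemma direct_sum_neg_ln (R : realType) :
  direct_sum (@neg_ln R) (fenchel_conjugate (@neg_ln R)) = @separable_log R.
Proof.
apply/funext => -[x xs]; rewrite /direct_sum fenchel_conjugate_neg_ln /neg_ln.
rewrite /separable_log /=; case: ltP => x0 /=; last by case: ifP.
by case: ifPn => // xs0; rewrite -EFinD addrA.
Qed.

(** The bound adds ln t <= t - 1 at t = y p and at t = x q, which are both
    equal to 1 for (y, q) = (1 / p, 1 / x). *)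
Lemma autoconjugate_separable_log (R : realType) :
  autoconjugate (@separable_log R).
Proof.
split=> [z|x xs]; first by rewrite /separable_log; case: ifP.
rewrite /conjugate2 {2}/separable_log /=; case: ifPn => [/andP[x0 xs0]|].
  have p0 : 0 < - xs by rewrite oppr_gt0.
  apply: ereal_sup_fin => [[y ys] _ /=|e e0].
    rewrite /separable_log /=; case: ifPn => [/andP[y0 ys0]|_]; last first.
      by rewrite leNye.
    have q0 : 0 < - ys by rewrite oppr_gt0.
    have := ln_le_sub1 (mulr_gt0 y0 p0); have := ln_le_sub1 (mulr_gt0 x0 q0).
    by rewrite !lnM ?posrE// -EFinB lee_fin; lra.
  exists ((- xs)^-1, - x^-1) => //=.
  rewrite /separable_log /= invr_gt0 p0 oppr_lt0 invr_gt0 x0 /= opprK.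
  rewrite !lnV ?posrE// mulrN divff ?gt_eqF// invrN mulNr mulVf ?lt_eqF//.
  by rewrite -EFinB lee_fin; lra.
move=> nH; apply: ereal_sup_infty => M; case: (leP x 0) => x0.
  exists (1, - expR (M - xs)) => //=; rewrite /separable_log /= ltr01 oppr_lt0.
  rewrite expR_gt0 /= opprK expRK ln1 -EFinB lee_fin.
  have : x * expR (M - xs) <= 0 by rewrite mulr_le0_ge0// expR_ge0.
  lra.
have {nH} xs0 : 0 <= xs by move: nH; rewrite x0 /= -leNgt.
exists (expR (M + x), - 1) => //=; rewrite /separable_log /= expR_gt0 /=.
rewrite oppr_lt0 ltr01 opprK expRK ln1 -EFinB lee_fin.
have : 0 <= expR (M + x) * xs by rewrite mulr_ge0// expR_ge0.
lra.
Qed.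

Lemma representer_separable_log (R : realType) :
  representer (subdifferential (@neg_ln R)) (@separable_log R).
Proof.
move=> x xs; rewrite subdifferential_neg_ln /separable_log /=.
have eqt : 0 < x -> xs < 0 -> ln x + ln (- xs) = ln (- (x * xs)).
  by move=> x0 xs0; rewrite -mulrN lnM// posrE// oppr_gt0.
split; last first.
  move=> [x0 xxs]; have xs0 : xs < 0 by nra.
  by rewrite x0 xs0 xxs /= -opprD eqt// xxs opprK ln1 oppr0 sub0r.
case: ifPn => // /andP[x0 xs0] [h]; split=> //.
have t0 : 0 < - (x * xs) by rewrite -mulrN mulr_gt0// oppr_gt0.
have [t1|t1] := eqVneq (- (x * xs)) 1; first by rewrite -t1 opprK.
by have := ln_lt_sub1 t0 t1; rewrite -eqt//; lra.
Qed.

Lemma domain_separable_log (R : realType) :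
  domain (@separable_log R) = `]0, +oo[ `*` `]-oo, 0[.
Proof.
apply/seteqP; split=> [[x xs]|[x xs]]; rewrite /domain /separable_log /=.
  by case: ifPn => // /andP[x0 xs0] _; rewrite !in_itv /= andbT.
by rewrite !in_itv /= andbT => -[-> ->]; rewrite ltry.
Qed.

(** * calB as an attained minimum, and weak duality *)

(** The points of C that the infimum in calB at (x, - p) may use: the remaining
    point 2 (x, p) - c must lie in the domain of the Fitzpatrick function. *)
Definition feasible (R : realType) (x p : R) : set (R * R) :=
  [set c | [/\ 0 < c.1, 1 <= c.1 * c.2, c.1 <= 2 * x & c.2 <= 2 * p]].

(** Half of F at 2 (x, p) - c, plus half of G at c, plus the quadratic term,
    whose argument (x, p) - c is half the difference of the two points.  The
    constants 1/2 and - 1/2 of F and G cancel. *)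
Definition cost (R : realType) (x p : R) (c : R * R) : R :=
  ((c.1 - x) ^+ 2 + (c.2 - p) ^+ 2) / 2
  - Num.sqrt ((2 * x - c.1) * (2 * p - c.2)).

Lemma calB_neg_ln (R : realType) (x p : R) :
  calB (subdifferential (@neg_ln R)) (x, - p)
  = ereal_inf [set (cost x p c)%:E | c in feasible x p].
Proof.
rewrite /calB conjugate_fitzpatrick_neg_ln fitzpatrick_neg_ln /=.
apply/eqP; rewrite eq_le; apply/andP; split; apply: le_ereal_inf_tmp.
  move=> _ [[c d] [/= c0 cd cx dp] <-].
  apply: ereal_inf_lbound; exists (x - c, d - p) => //=.
  rewrite /fitzpatrick_log /conjugate_log /=.
  have -> : x + (x - c) = 2 * x - c by ring.
  have -> : - p + (d - p) = - (2 * p - d) by ring.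
  have -> : x - (x - c) = c by ring.
  have -> : - p - (d - p) = - d by ring.
  have -> /= : 0 <= 2 * x - c by lra.
  have -> : - (2 * p - d) <= 0 by lra.
  have -> : c * - d <= -1 by lra.
  rewrite c0 /= -!EFinM -!EFinD; congr EFin.
  have -> : - ((2 * x - c) * - (2 * p - d)) = (2 * x - c) * (2 * p - d) by ring.
  by rewrite !real_normK ?num_real// /cost /=; field.
move=> _ [[y ys] _ <-] /=; rewrite /fitzpatrick_log /conjugate_log /=.
case: ifPn => [/andP[x0 h1]|_]; last first.
  by case: ifPn => _; rewrite gt0_muley ?lte_fin ?divr_gt0 -?EFinM ?addye ?leey.
case: ifPn => [/andP[x1 h2]|_]; last first.
  by rewrite gt0_muley ?lte_fin ?divr_gt0// -EFinM addey// ?addye ?leey.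
apply: ereal_inf_lbound; exists (x - y, p + ys) => /=.
  by split=> /=; [|lra|lra|lra].
rewrite -!EFinM -!EFinD; congr EFin.
rewrite !real_normK ?num_real// /cost /=.
have -> : (2 * x - (x - y)) * (2 * p - (p + ys)) = - ((x + y) * (- p + ys)).
  by ring.
by field.
Qed.

Lemma calB_neg_ln_le (R : realType) (x p : R) (c : R * R) : feasible x p c ->
  (calB (subdifferential (@neg_ln R)) (x, - p)%R <= (cost x p c)%:E)%E.
Proof. by rewrite calB_neg_ln => ?; apply: ereal_inf_lbound; exists c. Qed.

Lemma feasible_bound (R : realType) (x p : R) (c : R * R) :
  feasible x p c -> 0 < x /\ 1 <= 4 * (x * p).
Proof.
case: c => c d [/= c0 cd cx dp]; split; first lra.
have d0 : 0 < d by nra.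
have : c * d <= (2 * x) * (2 * p) by apply: ler_pM => //; exact: ltW.
lra.
Qed.

Lemma calB_neg_ln_infty (R : realType) (x p : R) :
  ~ (0 < x /\ 1 <= 4 * (x * p)) ->
  calB (subdifferential (@neg_ln R)) (x, - p) = +oo%E.
Proof.
move=> nH; rewrite calB_neg_ln (_ : feasible x p = set0) ?image_set0 ?ereal_inf0//.
by apply/seteqP; split=> // c /feasible_bound /nH.
Qed.

Lemma compact_feasible (R : realType) (x p : R) : compact (feasible x p).
Proof.
have -> : feasible x p
    = (`[0, 2 * x] `*` `[0, 2 * p])
      `&` ((fun c : R * R => c.1 * c.2) @^-1` [set u | 1 <= u]).
  apply/seteqP; split=> [[c d]|[c d]]; rewrite /feasible /= !in_itv /=.
    by move=> [c0 cd -> ->]; split=> //; split; apply/andP; split=> //; nra.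
  by move=> [[/andP[c0 ->] /andP[d0 ->]] cd]; split=> //; nra.
apply: compact_closedI; first by apply: compact_setX; exact: segment_compact.
apply: closed_comp; last exact: closed_ge.
by move=> c _; exact: mul_continuous.
Qed.

Lemma continuous_cost (R : realType) (x p : R) : continuous (cost x p).
Proof.
move=> c.
have c1 : {for c, continuous (fun c : R * R => c.1)} by exact: cvg_fst.
have c2 : {for c, continuous (fun c : R * R => c.2)} by exact: cvg_snd.
have d1 : {for c, continuous (fun c : R * R => c.1 - x)}.
  by apply: continuousB => //; exact: cst_continuous.
have d2 : {for c, continuous (fun c : R * R => c.2 - p)}.
  by apply: continuousB => //; exact: cst_continuous.
have n1 : {for c, continuous
    (fun c : R * R =>
      ((c.1 - x) * (c.1 - x) + (c.2 - p) * (c.2 - p)) / 2)}.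
  apply: continuousM; last exact: cst_continuous.
  by apply: continuousD; apply: continuousM.
have n2 : {for c, continuous
    (fun c : R * R => Num.sqrt ((2 * x - c.1) * (2 * p - c.2)))}.
  apply: continuous_comp; last exact: sqrt_continuous.
  by apply: continuousM; apply: continuousB => //; exact: cst_continuous.
exact: (continuousB n1 n2).
Qed.

Lemma calB_neg_ln_attained (R : realType) (x p : R) :
  0 < x -> 1 <= 4 * (x * p) ->
  exists c, [/\ feasible x p c,
    forall d, feasible x p d -> cost x p c <= cost x p d &
    calB (subdifferential (@neg_ln R)) (x, - p) = (cost x p c)%:E].
Proof.
move=> x0 xp.
have nonempty : feasible x p !=set0.
  by exists (2 * x, 2 * p); split=> //=; nra.
have [c cF cmin] := compact_EVT_min nonempty (@compact_feasible _ x p)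
  (continuous_subspaceT (@continuous_cost _ x p)).
exists c; rewrite inE in cF; split=> // [d dF|]; first by apply: cmin; rewrite inE.
apply/eqP; rewrite eq_le calB_neg_ln_le//= calB_neg_ln.
apply: le_ereal_inf_tmp => _ [d dF <-].
by rewrite lee_fin cmin// inE.
Qed.

(** Put a = 2 (x, p) - c and b = 2 (y, q) - d.  As c and d lie in C,
    2 sqrt (a1 a2) <= a1 d2 + a2 d1 and 2 sqrt (b1 b2) <= b1 c2 + b2 c1.  With
    v = c - (x, p) and w = d - (y, q), the right sides add up to
    2 (y p + x q) - 2 (v1 w2 + v2 w1), and the quadratic terms of the two costs
    dominate - (v1 w2 + v2 w1). *)
Lemma cost_weak_duality (R : realType) (x p y q : R) (c d : R * R) :
  feasible x p c -> feasible y q d ->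
  - (y * p + x * q) - cost y q d <= cost x p c.
Proof.
case: c d => [c1 c2] [d1 d2] [/= c10 c12 c1x c2p] [/= d10 d12 d1y d2q].
rewrite /cost /=.
have c20 : 0 <= c2 by nra.
have d20 : 0 <= d2 by nra.
have a1 : 0 <= 2 * x - c1 by lra.
have a2 : 0 <= 2 * p - c2 by lra.
have b1 : 0 <= 2 * y - d1 by lra.
have b2 : 0 <= 2 * q - d2 by lra.
have sc : 1 <= Num.sqrt (c1 * c2) by rewrite -sqrtr1 ler_wsqrtr.
have sd : 1 <= Num.sqrt (d1 * d2) by rewrite -sqrtr1 ler_wsqrtr.
have := cross_amgm a1 a2 (ltW d10) d20.
have := cross_amgm b1 b2 (ltW c10) c20.
set r := Num.sqrt ((2 * x - c1) * _); set s := Num.sqrt ((2 * y - d1) * _).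
have r0 : 0 <= r by exact: sqrtr_ge0.
have s0 : 0 <= s by exact: sqrtr_ge0.
have : r <= r * Num.sqrt (d1 * d2) by rewrite ler_peMr.
have : s <= s * Num.sqrt (c1 * c2) by rewrite ler_peMr.
have := sqr_ge0 ((c1 - x) + (d2 - q)); have := sqr_ge0 ((c2 - p) + (d1 - y)).
lra.
Qed.

(** Only d in C is required of the second point, not its feasibility: the box
    constraints are checked at the intermediate point alone.  This lets the
    first-order condition range over all of C. *)
Lemma feasible_convex (R : realType) (x p : R) (c d : R * R) (u : R) :
  feasible x p c -> 0 < d.1 -> 1 <= d.1 * d.2 -> 0 <= u <= 1 ->
  c.1 + u * (d.1 - c.1) <= 2 * x -> c.2 + u * (d.2 - c.2) <= 2 * p ->
  feasible x p (c.1 + u * (d.1 - c.1), c.2 + u * (d.2 - c.2)).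
Proof.
case: c d => [c1 c2] [d1 d2] [/= c10 c12 _ _] d10 d12 /andP[u0 u1] hx hp.
split=> //=; first by nra.
have c20 : 0 < c2 by nra.
have d20 : 0 < d2 by nra.
have sc : 1 <= Num.sqrt (c1 * c2) by rewrite -sqrtr1 ler_wsqrtr.
have sd : 1 <= Num.sqrt (d1 * d2) by rewrite -sqrtr1 ler_wsqrtr.
have := cross_amgm (ltW c10) (ltW c20) (ltW d10) (ltW d20).
have := mulr_ege1 sc sd => cd1 cd2.
have -> : (c1 + u * (d1 - c1)) * (c2 + u * (d2 - c2))
  = (1 - u) ^+ 2 * (c1 * c2) + u ^+ 2 * (d1 * d2)
    + u * (1 - u) * (d1 * c2 + c1 * d2) by ring.
have h1 : (1 - u) ^+ 2 <= (1 - u) ^+ 2 * (c1 * c2) by rewrite ler_peMr ?sqr_ge0.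
have h2 : u ^+ 2 <= u ^+ 2 * (d1 * d2) by rewrite ler_peMr ?sqr_ge0.
have h3 : u * (1 - u) * 2 <= u * (1 - u) * (d1 * c2 + c1 * d2).
  by apply: ler_wpM2l; [rewrite mulr_ge0//; lra|lra].
lra.
Qed.

(** A nonnegative one-sided perturbation has a nonnegative derivative; this
    replaces differentiation in the first-order conditions. *)
Lemma linear_ge0_of_quadratic (R : realType) (L M t0 : R) : 0 < t0 ->
  (forall t, 0 < t <= t0 -> 0 <= t * L + t ^+ 2 * M) -> 0 <= L.
Proof.
move=> t00 H; rewrite leNgt; apply/negP => L0.
have nM := normr_ge0 M.
pose t1 := - L / (2 * (`|M| + 1)).
have t10 : 0 < t1 by rewrite divr_gt0// ?oppr_gt0//; lra.
have t1E : t1 * (2 * (`|M| + 1)) = - L by rewrite divfK// gt_eqF//; lra.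
pose t := Num.min t0 t1.
have t_gt0 : 0 < t by rewrite lt_min t00.
have tt0 : t <= t0 by rewrite ge_min lexx.
have tt1 : t <= t1 by rewrite ge_min lexx orbT.
have := H t; rewrite t_gt0 tt0 => /(_ isT).
rewrite expr2 -mulrA -mulrDr pmulr_rge0//.
have : t * M <= t * `|M| by rewrite ler_pM2l// ler_norm.
have : t * `|M| <= t1 * `|M| by rewrite ler_wpM2r.
nra.
Qed.

(** * First-order conditions at a minimizer *)

Definition minimizer (R : realType) (x p : R) (c : R * R) :=
  feasible x p c /\ forall d, feasible x p d -> cost x p c <= cost x p d.

(** Comparing costs at c and c + u (d - c): the gain in the square root is at
    most the growth of the quadratic part. *)
Lemma minimizer_along (R : realType) (x p : R) (c d : R * R) (u : R) :
  minimizer x p c -> 0 < d.1 -> 1 <= d.1 * d.2 -> 0 < u <= 1 ->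
  c.1 + u * (d.1 - c.1) <= 2 * x -> c.2 + u * (d.2 - c.2) <= 2 * p ->
  Num.sqrt ((2 * x - c.1 - u * (d.1 - c.1)) * (2 * p - c.2 - u * (d.2 - c.2)))
  - Num.sqrt ((2 * x - c.1) * (2 * p - c.2)) <=
  u * ((d.1 - c.1) * (c.1 - x) + (d.2 - c.2) * (c.2 - p))
  + u ^+ 2 * (((d.1 - c.1) ^+ 2 + (d.2 - c.2) ^+ 2) / 2).
Proof.
move=> [cF cmin] d0 dd /andP[u0 u1] hx hp.
have := cmin _ (feasible_convex cF d0 dd _ hx hp).
rewrite (ltW u0) u1 => /(_ isT); rewrite /cost /= !opprD !addrA; lra.
Qed.

(** At a boundary point of the quadrant the square root has infinite slope
    inward, so moving from c towards a point d strictly inside both constraints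
    lowers the cost.  Such a d = l (2 x, 2 p) with l < 1 exists because
    4 x p > 1.  At the corner a = b = 0 the slope is finite, but there the
    quadratic part decreases too. *)
Lemma minimizer_slack (R : realType) (x p : R) (c : R * R) :
  0 < x -> 1 < 4 * (x * p) -> minimizer x p c ->
  0 < 2 * x - c.1 /\ 0 < 2 * p - c.2.
Proof.
move=> x0 xp cm; have [[c0 cd cx cp] _] := cm.
have p0 : 0 < p by nra.
apply/andP; apply: contraT => nslack.
have a0 : 0 <= 2 * x - c.1 by lra.
have b0 : 0 <= 2 * p - c.2 by lra.
set a := 2 * x - c.1 in nslack a0; set b := 2 * p - c.2 in nslack b0.
have ab0 : a * b = 0.
  move: nslack; rewrite !lt0r a0 b0 !andbT negb_and !negbK.
  by case/orP => /eqP ->; rewrite ?mul0r ?mulr0.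
(* With k = 4 x p, l = (1 + 1/k) / 2 is below 1, and l^2 k = (k + 1)^2 / (4 k)
   is at least 1. *)
pose l := 1 / 2 + 1 / (8 * (x * p)).
have xp8 : 0 < 8 * (x * p) by lra.
have lE : l * (8 * (x * p)) = 4 * (x * p) + 1.
  by rewrite mulrDl divfK ?gt_eqF//; lra.
have l0 : 0 < l by rewrite addr_gt0 ?divr_gt0.
have l1 : 0 < 1 - l by nra.
have dd : 1 <= (l * (2 * x)) * (l * (2 * p)).
  have : 4 * (x * p) * (l * (2 * x) * (l * (2 * p)) - 1)
      = (4 * (x * p) - 1) ^+ 2 / 4.
    have -> : 4 * (x * p) * (l * (2 * x) * (l * (2 * p)) - 1)
      = (l * (8 * (x * p))) ^+ 2 / 4 - 4 * (x * p) by field.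
    by rewrite lE; field.
  have : 0 <= (4 * (x * p) - 1) ^+ 2 by exact: sqr_ge0.
  by nra.
pose d := (l * (2 * x), l * (2 * p)).
have d0 : 0 < d.1 by rewrite mulr_gt0// mulr_gt0.
pose L := (d.1 - c.1) * (c.1 - x) + (d.2 - c.2) * (c.2 - p).
pose M := ((d.1 - c.1) ^+ 2 + (d.2 - c.2) ^+ 2) / 2.
pose a' := (1 - l) * (2 * x); pose b' := (1 - l) * (2 * p).
have a'0 : 0 < a' by rewrite mulr_gt0// mulr_gt0.
have b'0 : 0 < b' by rewrite mulr_gt0// mulr_gt0.
have da : d.1 - c.1 = a - a' by rewrite /a /a' /=; ring.
have db : d.2 - c.2 = b - b' by rewrite /b /b' /=; ring.
have pa u : 0 <= u <= 1 -> 0 <= (1 - u) * a + u * a'.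
  by move=> /andP[u0 u1]; apply: addr_ge0; apply: mulr_ge0 => //; lra.
have pb u : 0 <= u <= 1 -> 0 <= (1 - u) * b + u * b'.
  by move=> /andP[u0 u1]; apply: addr_ge0; apply: mulr_ge0 => //; lra.
have main u : 0 < u <= 1 ->
    Num.sqrt (((1 - u) * a + u * a') * ((1 - u) * b + u * b'))
    <= u * L + u ^+ 2 * M.
  move=> /andP[u0 u1].
  have := minimizer_along cm d0 dd _ _ _; rewrite -/L -/M => /(_ u).
  rewrite u0 u1 da db -/a -/b ab0 sqrtr0 subr0 => /(_ isT).
  have -> : a - u * (a - a') = (1 - u) * a + u * a' by ring.
  have -> : b - u * (b - b') = (1 - u) * b + u * b' by ring.
  apply.
    have := pa u; rewrite (ltW u0) u1 => /(_ isT).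
    have -> : (1 - u) * a + u * a' = a - u * (a - a') by ring.
    by rewrite {1}/a; lra.
  have := pb u; rewrite (ltW u0) u1 => /(_ isT).
  have -> : (1 - u) * b + u * b' = b - u * (b - b') by ring.
  by rewrite {1}/b; lra.
(* The product under the root is at least u (1 - u) (a b' + b a'), of order u
   unless a = b = 0. *)
have [k0|k0] := leP (a * b' + b * a') 0.
  have a00 : a = 0 by nra.
  have b00 : b = 0 by nra.
  have L0 : 0 <= L.
    apply: (@linear_ge0_of_quadratic R L M 1) => // u hu.
    by apply: le_trans (main u hu); exact: sqrtr_ge0.
  suff : L < 0 by rewrite ltNge L0.
  rewrite /L da db a00 b00 !sub0r; move: a00 b00; rewrite /a /b => a00 b00.
  have -> : c.1 - x = x by lra.
  have -> : c.2 - p = p by lra.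
  by nra.
suff : 0 <= - (a * b' + b * a') / 2 by lra.
pose N := `|L| + `|M|.
apply: (@linear_ge0_of_quadratic R _ (N ^+ 2) (1 / 2)) => // u /andP[u0 u1].
have := main u; rewrite u0 /= => /(_ ltac:(lra)).
set S := Num.sqrt _.
have S0 : 0 <= S by exact: sqrtr_ge0.
have prod0 : 0 <= ((1 - u) * a + u * a') * ((1 - u) * b + u * b').
  by apply: mulr_ge0; [apply: pa|apply: pb]; lra.
have SE : S ^+ 2 = u * (1 - u) * (a * b' + b * a') + u ^+ 2 * (a' * b').
  rewrite sqr_sqrtr//.
  transitivity ((1 - u) ^+ 2 * (a * b) + u * (1 - u) * (a * b' + b * a')
     + u ^+ 2 * (a' * b')); first by ring.
  by rewrite ab0; ring.
move=> hS.
have SN : S <= u * N.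
  apply: (le_trans hS); rewrite [u * N]mulrDr; apply: lerD.
    by rewrite ler_pM2l// ler_norm.
  rewrite expr2 -mulrA ler_pM2l//.
  have h : u * `|M| <= 1 * `|M| by apply: ler_wpM2r => //; lra.
  have : u * M <= u * `|M| by rewrite ler_pM2l// ler_norm.
  lra.
have : S ^+ 2 <= u ^+ 2 * N ^+ 2.
  by rewrite -exprMn ler_sqr ?nnegrE// (le_trans S0).
rewrite SE.
have : 0 <= u ^+ 2 * (a' * b') by rewrite mulr_ge0 ?sqr_ge0// mulr_ge0 ?ltW.
have : u * (1 / 2) * (a * b' + b * a') <= u * (1 - u) * (a * b' + b * a').
  by rewrite ler_pM2r// ler_pM2l//; lra.
lra.
Qed.

(** The two coefficients are the partial derivatives of the cost at c, written
    with t = sqrt (a / b) and r = sqrt (a b) for (a, b) = 2 (x, p) - c.  The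
    expansion of the square root to first order uses that the geometric mean is
    at least the harmonic one, sqrt (v w) >= (v + w) / 2 - (v - w)^2 / (2 (v + w)),
    so that the error is quadratic in the step. *)
Lemma minimizer_stationary (R : realType) (x p t r : R) (c d : R * R) :
  minimizer x p c -> 0 < t -> 0 < r ->
  2 * x - c.1 = r * t -> 2 * p - c.2 = r / t ->
  0 < d.1 -> 1 <= d.1 * d.2 ->
  0 <= (c.1 - x + t^-1 / 2) * (d.1 - c.1) + (c.2 - p + t / 2) * (d.2 - c.2).
Proof.
move=> cm t0 r0 ax bp d0 dd.
have ti0 : 0 < t^-1 by rewrite invr_gt0.
set h := d.1 - c.1; set k := d.2 - c.2.
pose D := (h / t - k * t) ^+ 2 / (2 * r).
pose L := h * (c.1 - x) + k * (c.2 - p); pose M := (h ^+ 2 + k ^+ 2) / 2.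
have -> : (c.1 - x + t^-1 / 2) * h + (c.2 - p + t / 2) * k
  = L + (h / t + k * t) / 2 by rewrite /L; field; exact: lt0r_neq0.
have nh := normr_ge0 h; have nk := normr_ge0 k.
have lh := ler_norm h; have lk := ler_norm k.
(* For steps up to u0 the slacks 2 x - c1 and 2 p - c2 keep at least half
   of their size, which makes the moved point feasible and keeps v + w >= r. *)
pose u0 := Num.min 1 (Num.min (r * t / (2 * (`|h| + 1))) (r / t / (2 * (`|k| + 1)))).
have u00 : 0 < u0.
  by rewrite !lt_min ltr01 !divr_gt0 ?mulr_gt0//; lra.
apply: (@linear_ge0_of_quadratic R _ (M + D) u0) => // u /andP[u_gt0].
rewrite !le_min => /and3P[u1 uh uk].
have {}uh : u * h <= r * t / 2.
  move: uh; rewrite ler_pdivlMr; last lra.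
  have : u * h <= u * `|h| by rewrite ler_pM2l.
  lra.
have {}uk : u * k <= r / t / 2.
  move: uk; rewrite ler_pdivlMr; last lra.
  have : u * k <= u * `|k| by rewrite ler_pM2l.
  lra.
have rt0 : 0 < r * t by rewrite mulr_gt0.
have rti0 : 0 < r / t by rewrite mulr_gt0.
have := minimizer_along cm d0 dd _ _ _; rewrite -/h -/k => /(_ u).
rewrite u_gt0 u1 ax bp -/L -/M => /(_ isT).
have e1 : c.1 + u * h <= 2 * x by lra.
have e2 : c.2 + u * k <= 2 * p by lra.
move=> /(_ e1 e2).
have -> : r * t * (r / t) = r ^+ 2 by field; exact: lt0r_neq0.
rewrite sqrtr_sqr gtr0_norm//.
set v := r - u * (h / t); set w := r - u * (k * t).
have -> : (r * t - u * h) * (r / t - u * k) = v * w.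
  by rewrite /v /w; field; exact: lt0r_neq0.
have v0 : r / 2 <= v.
  have : u * h / t <= r * t / 2 / t by rewrite ler_pM2r.
  have -> : r * t / 2 / t = r / 2 by field; exact: lt0r_neq0.
  by rewrite /v mulrA; lra.
have w0 : r / 2 <= w.
  have : u * k * t <= r / t / 2 * t by rewrite ler_pM2r.
  have -> : r / t / 2 * t = r / 2 by field; exact: lt0r_neq0.
  by rewrite /w mulrA; lra.
have : (v + w) / 2 - u ^+ 2 * D <= Num.sqrt (v * w).
  have -> : u ^+ 2 * D = (v - w) ^+ 2 / (2 * r).
    by rewrite /D /v /w; field; rewrite !lt0r_neq0.
  apply: (@le_trans _ _ ((v + w) / 2 - (v - w) ^+ 2 / (2 * (v + w)))).
    rewrite lerB// ler_wpM2l ?sqr_ge0// lef_pV2 ?posrE; lra.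
  apply: le_sqrt_of_sqr.
  have -> : (v + w) / 2 - (v - w) ^+ 2 / (2 * (v + w)) = 2 * (v * w) / (v + w).
    by field; apply: lt0r_neq0; lra.
  rewrite expr_div_n ler_pdivrMr; last by rewrite exprn_gt0//; lra.
  have vw0 : 0 < v * w by rewrite mulr_gt0//; lra.
  have -> : (2 * (v * w)) ^+ 2 = v * w * (4 * (v * w)) by ring.
  rewrite ler_pM2l//; have := sqr_ge0 (v - w); nra.
rewrite /v /w; lra.
Qed.

(** * Strong duality and the properties of calB *)

(** In the interior 4 x p > 1, let (g, h) be the gradient of the cost at c.  By
    the variational inequality, (g, h) . c is the minimum of (g, h) over C,
    that is 2 sqrt (g h).  Take d = (t, 1/t), the direction in which the
    Fenchel-Young inequality for the slack 2 (x, p) - c is sharp, and (y, q)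
    with 2 (y, q) - d = (2 h, 2 g), for which the one for c is sharp.  Then
    d - (y, q) = - (c2 - p, c1 - x), which is the equality case of the quadratic
    part of [cost_weak_duality]. *)
Lemma cost_strong_duality (R : realType) (x p e : R) (c : R * R) :
  minimizer x p c -> 0 < e ->
  exists y q d, feasible y q d /\
    cost x p c - e <= - (y * p + x * q) - cost y q d.
Proof.
move=> cm e0; have [cF _] := cm; have [x0] := feasible_bound cF.
have [c0 cd cx cp] := cF.
rewrite le_eqVlt => /predU1P[xp1|xp].
  have p0 : 0 < p by nra.
  have d0 : 0 < c.2 by nra.
  have c1E : c.1 = 2 * x.
    by apply/eqP; rewrite eq_le cx /=; nra.
  have c2E : c.2 = 2 * p.
    by apply/eqP; rewrite eq_le cp /=; nra.
  (* On the boundary the only feasible point is c = 2 (x, p), and the slack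
     vanishes; any d in C is then sharp for it.  The dual points l (x, p), sharp
     for c, and d = l (x, p) - 2 (p, x) reach the value; l = 8 (x^2 + p^2) puts
     d on the hyperbola, and 4 x p = 1 simplifies the coordinates. *)
  have xp3 : (8 * x ^+ 3) * (8 * p ^+ 3) = 1.
    have -> : (8 * x ^+ 3) * (8 * p ^+ 3) = (4 * (x * p)) ^+ 3 by ring.
    by rewrite -xp1 expr1n.
  have x3 : 0 < 8 * x ^+ 3 by rewrite mulr_gt0// exprn_gt0.
  have p3 : 0 < 8 * p ^+ 3 by rewrite mulr_gt0// exprn_gt0.
  exists (8 * x ^+ 3 + p), (8 * p ^+ 3 + x), (8 * x ^+ 3, 8 * p ^+ 3); split.
    by split=> /=; lra.
  pose N := x ^+ 2 + p ^+ 2.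
  have lin : (8 * x ^+ 3 + p) * p + x * (8 * p ^+ 3 + x) = 3 * N.
    transitivity (2 * (4 * (x * p)) * N + N); first by rewrite /N; ring.
    by rewrite -xp1; lra.
  have prod : (2 * (8 * x ^+ 3 + p) - 8 * x ^+ 3)
      * (2 * (8 * p ^+ 3 + x) - 8 * p ^+ 3) = (4 * N) ^+ 2.
    transitivity ((8 * x ^+ 3) * (8 * p ^+ 3) + 4 * (x * p)
      - 2 * (4 * (x * p)) ^+ 2 + (4 * N) ^+ 2); first by rewrite /N; ring.
    by rewrite xp3 -xp1; lra.
  have N0 : 0 <= 4 * N by rewrite mulr_ge0// addr_ge0 ?sqr_ge0.
  rewrite lin /cost /= prod sqrtr_sqr ger0_norm// c1E c2E !subrr mul0r sqrtr0.
  rewrite /N; lra.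
have [a0 b0] := minimizer_slack x0 xp cm.
set a := 2 * x - c.1 in a0; set b := 2 * p - c.2 in b0.
pose r := Num.sqrt (a * b).
have r0 : 0 < r by rewrite sqrtr_gt0 mulr_gt0.
have r2 : r ^+ 2 = a * b by rewrite sqr_sqrtr// ltW// mulr_gt0.
pose t := r / b.
have t0 : 0 < t by rewrite divr_gt0.
have ti0 : 0 < t^-1 by rewrite invr_gt0.
have aE : a = r * t by rewrite /t mulrA -expr2 r2 mulfK// gt_eqF.
have bE : b = r / t.
  by rewrite /t invf_div mulrCA divff ?mulr1// gt_eqF.
have d0 : 0 < c.2 by nra.
pose g := c.1 - x + t^-1 / 2; pose h := c.2 - p + t / 2.
(* As t = sqrt (a / b), the partial derivatives of sqrt (a b) in a and b are
   t^-1 / 2 and t / 2, so (g, h) is the gradient of the cost at c. *)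
have VI d : 0 < d.1 -> 1 <= d.1 * d.2 ->
    g * c.1 + h * c.2 <= g * d.1 + h * d.2.
  move=> d10 dd; have := minimizer_stationary cm t0 r0 aE bE d10 dd.
  by rewrite -/g -/h; lra.
(* C is stable under increasing either coordinate. *)
have g0 : 0 <= g.
  have := VI (c.1 + 1, c.2) => /=; rewrite addr_gt0// => /(_ isT).
  by move=> H; have : 1 <= (c.1 + 1) * c.2 by [nra|]; move=> /H; lra.
have h0 : 0 <= h.
  have := VI (c.1, c.2 + 1) => /=; rewrite c0 => /(_ isT).
  by move=> H; have : 1 <= c.1 * (c.2 + 1) by [nra|]; move=> /H; lra.
have [z z0 hz] := hyperbola_approx_min g0 h0 e0.
have cmp : g * c.1 + h * c.2 <= 2 * Num.sqrt (g * h) + e.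
  apply: le_trans hz; have := VI (z^-1, z) => /=.
  by rewrite invr_gt0 mulVf ?gt_eqF// (mulrC z) => /(_ z0 (lexx _)).
exists (h + t / 2), (g + t^-1 / 2), (t, t^-1); split.
  by split=> //=; [rewrite divff// gt_eqF|lra|lra].
rewrite /cost /= -/a -/b -/r.
have -> : (2 * (h + t / 2) - t) * (2 * (g + t^-1 / 2) - t^-1)
  = 2 ^+ 2 * (g * h).
  by field; exact: lt0r_neq0.
rewrite sqrtrM ?sqr_ge0// sqrtr_sqr ger0_norm//.
have rE : 2 * r = a / t + t * b.
  by rewrite aE bE; field; exact: lt0r_neq0.
move: cmp rE; rewrite /g /h /a /b; set s := Num.sqrt _ => cmp rE.
nra.
Qed.

Lemma cost_ge (R : realType) (x p : R) (c : R * R) :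
  feasible x p c -> - (x * p) <= cost x p c.
Proof. by move=> cF; have := cost_weak_duality cF cF; lra. Qed.

(** With v = c - (x, p), s^2 = a b and the identity
    a b + c1 c2 = 2 x p + 2 v1 v2, the difference cost + x p is half of
    (v1 - v2)^2 + (s - 1)^2 + (c1 c2 - 1).  When it vanishes, a b = c1 c2 = 1 and
    v1 = v2; then c1 c2 - a b = 2 v1 (x + p) gives v = 0. *)
Lemma cost_eq_coupling (R : realType) (x p : R) (c : R * R) :
  feasible x p c -> cost x p c = - (x * p) -> x * p = 1.
Proof.
move=> cF; have [x0 xp] := feasible_bound cF; move: cF.
case: c => c d [/= c0 cd cx dp]; rewrite /cost /=.
have ab0 : 0 <= (2 * x - c) * (2 * p - d) by rewrite mulr_ge0//; lra.
set s := Num.sqrt _.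
have s2 : s ^+ 2 = (2 * x - c) * (2 * p - d) by rewrite sqr_sqrtr.
move=> E.
have sum0 : ((c - x) - (d - p)) ^+ 2 + (s - 1) ^+ 2 + (c * d - 1) = 0.
  have : s ^+ 2 + c * d = 2 * (x * p) + 2 * ((c - x) * (d - p)).
    by rewrite s2; ring.
  lra.
have q1 := sqr_ge0 ((c - x) - (d - p)); have q2 := sqr_ge0 (s - 1).
have /eqP : ((c - x) - (d - p)) ^+ 2 = 0 by lra.
have /eqP : (s - 1) ^+ 2 = 0 by lra.
rewrite !sqrf_eq0 => /eqP s1 /eqP cdE.
have cd1 : c * d = 1 by lra.
have {}s1 : s = 1 by lra.
have p0 : 0 < p by nra.
have : (c - x) * (2 * (x + p)) = 0.
  have dE : d = p + (c - x) by lra.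
  move: s2 cd1; rewrite s1 dE expr1n => h1 h2; nra.
move/eqP; rewrite mulf_eq0 => /orP[/eqP cx0|]; last first.
  by move=> /eqP; lra.
have -> : x = c by lra.
by have -> : p = d by lra.
Qed.

(** On the domain, weak and strong duality give the two halves of the supremum.
    Off the domain, bounding calB at (y, - q) by the cost of c = (y, q) leaves
    sqrt (y q), which [hyperbola_unbounded] makes win. *)
Lemma autoconjugate_calB_neg_ln (R : realType) :
  autoconjugate (calB (subdifferential (@neg_ln R))).
Proof.
set B := calB _.
have infty x p : ~ (0 < x /\ 1 <= 4 * (x * p)) -> B (x, - p) = +oo%E.
  exact: calB_neg_ln_infty.
have attained x p : 0 < x -> 1 <= 4 * (x * p) -> exists2 c,
    minimizer x p c & B (x, - p) = (cost x p c)%:E.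
  by move=> x0 xp; have [c [? ? ?]] := calB_neg_ln_attained x0 xp; exists c.
have fin x p : {c | minimizer x p c & B (x, - p) = (cost x p c)%:E}
             + {B (x, - p) = +oo%E}.
  have [[x0 xp]|nH] := pselect (0 < x /\ 1 <= 4 * (x * p)).
    by left; apply: cid2; exact: attained.
  by right; exact: infty.
split=> [[x xs]|x xs].
  by rewrite -[xs]opprK; case: (fin x (- xs)) => [[c _ ->]|->].
rewrite -[xs]opprK; move: (- xs) => {xs} p; rewrite /conjugate2 /=.
have [[x0 xp]|nH] := pselect (0 < x /\ 1 <= 4 * (x * p)).
  have [c cm ->] := attained _ _ x0 xp.
  apply: ereal_sup_fin => [[y ys] _ /=|e e0].
    rewrite -[ys]opprK; case: (fin y (- ys)) => [[d [dF _] ->]|->]; last first.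
      by rewrite leNye.
    rewrite -EFinB lee_fin; have := cost_weak_duality cm.1 dF.
    lra.
  have [y [q [d [dF hd]]]] := cost_strong_duality cm e0.
  exists (y, - q) => //=; apply: (@le_trans _ _
    ((y * - p + x * - q)%:E - (cost y q d)%:E)%E).
    by rewrite -EFinB lee_fin; lra.
  by apply: leeB => //; exact: calB_neg_ln_le.
rewrite infty//; apply: ereal_sup_infty => M.
have [] := @hyperbola_unbounded R 1 x p M ltr01.
  by rewrite expr1n => -[? _ ?]; exact: nH.
move=> y [q [y0 q0 yq hM]]; exists (y, - q) => //=.
have dF : feasible y q (y, q) by split=> /=; lra.
apply: (@le_trans _ _ ((y * - p + x * - q)%:E - (cost y q (y, q))%:E)%E).
  rewrite -EFinB lee_fin /cost /= !subrr.
  have -> : (2 * y - y) * (2 * q - q) = y * q by ring.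
  by move: hM; lra.
by apply: leeB => //; exact: calB_neg_ln_le.
Qed.

(** On the graph, the point c = (x, p) itself has cost - 1, which is the general
    lower bound - x p. *)
Lemma representer_calB_neg_ln (R : realType) :
  representer (subdifferential (@neg_ln R))
    (calB (subdifferential (@neg_ln R))).
Proof.
move=> x xs; rewrite {2}subdifferential_neg_ln /= -[xs]opprK.
move: (- xs) => {xs} p; rewrite mulrN; split.
  have [[x0 xp]|nH] := pselect (0 < x /\ 1 <= 4 * (x * p)); last first.
    by rewrite calB_neg_ln_infty.
  have [c [cF _ ->]] := calB_neg_ln_attained x0 xp.
  by move=> [/(cost_eq_coupling cF) ->].
move=> [x0 xp1]; have {}xp1 : x * p = 1 by lra.
apply/eqP; rewrite eq_le; apply/andP; split.
  have xpF : feasible x p (x, p) by split=> /=; nra.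
  apply: (le_trans (calB_neg_ln_le xpF)); rewrite lee_fin /cost /= !subrr.
  have -> : (2 * x - x) * (2 * p - p) = x * p by ring.
  by rewrite xp1 sqrtr1; lra.
rewrite calB_neg_ln; apply: le_ereal_inf_tmp => _ [c cF <-].
by rewrite lee_fin; exact: cost_ge.
Qed.

Lemma scale_hyperbolic_set (R : realType) (t : R) : 0 < t ->
  scale_set t (@hyperbolic_set R)
  = [set z | 0 < z.1 /\ z.1 * z.2 <= - t ^+ 2].
Proof.
move=> t0; rewrite /scale_set /hyperbolic_set.
apply/seteqP; split=> [_ [[x xs] /= /andP[h1 h2] <-]|[x xs] /= [x0 h]] /=.
  have x0 : 0 < x by move: h2; rewrite oppr_lt0 div1r invr_gt0.
  have hx : x * xs <= -1.
    have : x * xs <= x * - (1 / x) by rewrite ler_pM2l.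
    by rewrite mulrN div1r divff ?gt_eqF.
  split; first by rewrite mulr_gt0.
  have : t ^+ 2 * (x * xs) <= t ^+ 2 * -1 by rewrite ler_pM2l// exprn_gt0.
  lra.
exists (x / t, xs / t) => /=; last first.
  by congr pair; rewrite mulrCA divff ?mulr1// gt_eqF.
have xt0 : 0 < x / t by rewrite divr_gt0.
rewrite div1r oppr_lt0 invr_gt0 xt0 andbT.
rewrite -(ler_pM2l xt0) mulrN divff ?gt_eqF// mulf_div ler_pdivrMr ?mulr_gt0//.
lra.
Qed.

Lemma domain_calA_neg_ln (R : realType) :
  domain (calA (subdifferential (@neg_ln R)))
  = scale_set (1 / Num.sqrt 2) hyperbolic_set.
Proof.
have s0 : 0 < Num.sqrt 2 :> R by rewrite sqrtr_gt0.
rewrite scale_hyperbolic_set ?divr_gt0// expr_div_n expr1n sqr_sqrtr//.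
rewrite calA_neg_ln; apply/seteqP; split=> z; rewrite /domain /average_log /=.
  by case: ifPn => // /andP[-> h] _; split=> //; lra.
move=> [-> h]; have -> : 2 * (z.1 * z.2) <= -1 by lra.
by rewrite ltry.
Qed.

Lemma domain_calB_neg_ln (R : realType) :
  domain (calB (subdifferential (@neg_ln R)))
  = scale_set (1 / 2) hyperbolic_set.
Proof.
rewrite scale_hyperbolic_set ?divr_gt0//.
have sq : (1 / 2) ^+ 2 = 1 / 4 :> R by field.
apply/seteqP; split=> -[x xs]; rewrite /domain /= sq -[xs]opprK;
  move: (- xs) => p.
  have [[x0 xp] _|nH] := pselect (0 < x /\ 1 <= 4 * (x * p)).
    by split=> //; lra.
  by rewrite calB_neg_ln_infty.
move=> [x0 h]; have xp : 1 <= 4 * (x * p) by lra.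
by have [c [_ _ ->]] := calB_neg_ln_attained x0 xp; rewrite ltry.
Qed.

Theorem theorem5p1 (R : realType) :
  let f : R -> \bar R := neg_ln in
  let C : set (R * R) := hyperbolic_set in
  let A : set (R * R) := subdifferential f in
  let FA : R * R -> \bar R := calA A in
  let FB : R * R -> \bar R := calB A in
  let FS : R * R -> \bar R := direct_sum f (fenchel_conjugate f) in
  [/\ domain FA = scale_set (1 / Num.sqrt 2) C,
      domain FB = scale_set (1 / 2) C &
      domain FS = `]0, +oo[ `*` `]-oo, 0[] /\
  [/\ autoconjugate_representer A FA,
      autoconjugate_representer A FB &
      autoconjugate_representer A FS] /\
  [/\ FA <> FB, FA <> FS & FB <> FS].
Proof.
move=> f C A FA FB FS.
have dA : domain FA = scale_set (1 / Num.sqrt 2) C := @domain_calA_neg_ln R.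
have dB : domain FB = scale_set (1 / 2) C := @domain_calB_neg_ln R.
have dS : domain FS = `]0, +oo[ `*` `]-oo, 0[.
  by rewrite /FS direct_sum_neg_ln domain_separable_log.
have s0 : 0 < Num.sqrt 2 :> R by rewrite sqrtr_gt0.
have inA (z : R * R) : domain FA z <-> 0 < z.1 /\ z.1 * z.2 <= - (1 / 2).
  by rewrite dA scale_hyperbolic_set ?divr_gt0// expr_div_n expr1n sqr_sqrtr.
have inB (z : R * R) : domain FB z <-> 0 < z.1 /\ z.1 * z.2 <= - (1 / 4).
  rewrite dB scale_hyperbolic_set ?divr_gt0//.
  by have -> : (1 / 2) ^+ 2 = 1 / 4 :> R by field.
have inS (z : R * R) : domain FS z <-> 0 < z.1 /\ z.2 < 0.
  by rewrite dS; split=> [[]|[]] /=; rewrite !in_itv /= andbT.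
split; first by [].
split; [split; split|split].
- by rewrite /FA calA_neg_ln; exact: autoconjugate_average_log.
- by rewrite /FA calA_neg_ln; exact: representer_average_log.
- exact: autoconjugate_calB_neg_ln.
- exact: representer_calB_neg_ln.
- by rewrite /FS direct_sum_neg_ln; exact: autoconjugate_separable_log.
- by rewrite /FS direct_sum_neg_ln; exact: representer_separable_log.
- move=> AB; have : domain FB (1 / 2, - (1 / 2)) by apply/inB => /=; split; lra.
  by rewrite -AB => /inA[/= _]; lra.
- move=> AS; have : domain FS (1 / 4, - (1 / 4)) by apply/inS => /=; split; lra.
  by rewrite -AS => /inA[/= _]; lra.
- move=> BS; have : domain FS (1 / 4, - (1 / 4)) by apply/inS => /=; split; lra.
  by rewrite -BS => /inB[/= _]; lra.
Qed.
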